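(* Assume the seeds are i.i.d. uniform on $[n]$. Fix $m\in\mathbb N$. Let $\mathcal E^*(m)$ be the set of maximizers of $\eta\mapsto p(\infty,m,\eta)$ over $[0,\tfrac12]$, and assume $\mathcal E^*(m)\subset(0,\tfrac12)$. For each even $n\ge6$ let $l_{opt}(n,m)\in\operatorname{arg\,max}_{l\in\{2,\dots,n/2-1\}}p_1(n,m,l)$. Then $$\lim_{n\to\infty}\ \inf_{\eta^*\in\mathcal E^*(m)}\Bigl|\frac{l_{opt}(n,m)}{n}-\eta^*\Bigr|=0.$$ If moreover $\mathcal E^*(m)=\{\eta_{opt}(m)\}$ is a singleton, then $\lim_{n\to\infty}l_{opt}(n,m)/n=\eta_{opt}(m)$.
   Context: Discrete model: candidates $[n]$, $m$ voters; voter $j$ has the clockwise oriented preference list $(s_j,s_j+1,\dots,n,1,\dots,s_j-1)$ with seed $s_j$; seeds independent uniform on $[n]$. In an election among a non-empty $S\subseteq[n]$ each voter votes for the first candidate of $S$ in its list; $\Xi_S(i)$ is the number of votes for $i$. Two-round election with partition $(A,B)$: the winner of $A$ is the $a\in A$ with $\Xi_A(a)>\Xi_A(a')$ for all other $a'\in A$ (if none, nobody wins); likewise for $B$; between first-round winners $a,b$, $a$ wins iff $\Xi_{\{a,b\}}(a)>\Xi_{\{a,b\}}(b)$ (ties: nobody wins). $A^{(1,n,l)}=\{1,\dots,l\}\cup\{l+2i:1\le i\le(n-2l)/2\}$, $B^{(1,n,l)}=[n]\setminus A^{(1,n,l)}$, and $p_1(n,m,l)$ is the probability that candidate 1 wins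 with partition $(A^{(1,n,l)},B^{(1,n,l)})$. Continuous model: $U_1,\dots,U_m$ i.i.d. uniform on $[0,1)$, $N_{(a,b)}$ the number of $U_j$ in the arc $(a,b)$ mod 1; $p(\infty,m,\eta)=\mathsf P(N_{(1-\eta,1)}\ge2,\ N_{(0,\eta)}\ge2,\ N_{(0,\eta)}<m/2)$, equivalently the polynomial $\sum_{s=2}^{\lfloor (m-1)/2\rfloor}\sum_{t=2}^{m-s}\frac{m!}{s!\,t!\,(m-s-t)!}\eta^{s+t}(1-2\eta)^{m-s-t}$, considered for $\eta\in[0,\tfrac12]$. *)

(* Defs.v *)
From HB Require Import structures.
From mathcomp Require Import all_boot all_order all_algebra.
From mathcomp Require Import all_classical all_reals all_analysis.
Set Implicit Arguments. Unset Strict Implicit. Unset Printing Implicit Defensive.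
Import Order.TTheory GRing.Theory Num.Theory.
Local Open Scope classical_set_scope.
Local Open Scope ring_scope.

(* Candidates are the naturals 1..n.  A seed vector is an element of
   {ffun 'I_m -> 'I_n}; voter j has seed (seeds j).+1 in [n], and the
   uniform distribution on {ffun 'I_m -> 'I_n} is the i.i.d. uniform seed law. *)

(* 0-based position of candidate c in the list (s, s+1, ..., n, 1, ..., s-1),
   for s, c in [1, n]. *)
Definition rank (n s c : nat) : nat := ((c + n - s) %% n)%N.

Definition votes_for (n : nat) (S : pred nat) (s i : nat) : bool :=
  (1 <= i <= n)%N && (i \in S) &&
  all (fun c => (c \in S) ==> (rank n s i <= rank n s c)%N) (iota 1 n).

Definition Xi (n m : nat) (S : pred nat) (seeds : {ffun 'I_m -> 'I_n}) (i : nat)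
  : nat := #|[set j : 'I_m | votes_for n S (seeds j).+1 i]|.

Definition winner (n m : nat) (S : pred nat) (seeds : {ffun 'I_m -> 'I_n})
  (a : nat) : bool :=
  (1 <= a <= n)%N && (a \in S) &&
  all (fun a' => ((a' \in S) && (a' != a)) ==> (Xi S seeds a' < Xi S seeds a)%N)
      (iota 1 n).

Definition pair_set (a b : nat) : pred nat := fun c => (c == a) || (c == b).

Definition wins2 (n m : nat) (A B : pred nat) (seeds : {ffun 'I_m -> 'I_n})
  (c : nat) : bool :=
  has (fun a => has (fun b =>
     [&& winner A seeds a, winner B seeds b &
      ((c == a) && (Xi (pair_set a b) seeds a > Xi (pair_set a b) seeds b)%N)
      || ((c == b) && (Xi (pair_set a b) seeds b > Xi (pair_set a b) seeds a)%N)])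
    (iota 1 n)) (iota 1 n).

Definition Apart (n l : nat) : pred nat := fun c =>
  ((1 <= c <= l)%N) || has (fun i => c == (l + 2 * i)%N) (iota 1 ((n - 2 * l)./2)).
Definition Bpart (n l : nat) : pred nat := fun c =>
  (1 <= c <= n)%N && ~~ Apart n l c.

Definition p1 {R : realType} (n m l : nat) : R :=
  (#|[set s : {ffun 'I_m -> 'I_n} | wins2 (Apart n l) (Bpart n l) s 1%N]|%:R)
  / ((n ^ m)%N)%:R.

Definition pinf {R : realType} (m : nat) (eta : R) : R :=
  \sum_(2 <= s < ((m - 1) %/ 2).+1)
   \sum_(2 <= t < (m - s).+1)
     ((m`!)%:R / ((s`! * t`! * (m - s - t)`!)%N)%:R)
       * eta ^+ (s + t) * (1 - 2 * eta) ^+ (m - s - t).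

Definition Estar {R : realType} (m : nat) : set R :=
  [set eta | 0 <= eta <= 2^-1 /\
     forall x : R, 0 <= x <= 2^-1 -> pinf m x <= pinf m eta].

(* Main.v *)
Require Import Defs.
From HB Require Import structures.
From mathcomp Require Import all_boot all_order all_algebra.
From mathcomp Require Import all_classical all_reals all_analysis.
From mathcomp Require Import zify ring lra.
Import Order.TTheory GRing.Theory Num.Theory numFieldNormedType.Exports.
Local Open Scope ring_scope.

(** Unless some seed equals 1 or two voters have equal or adjacent seeds, every
candidate other than 1 in A and l+1 in B gets at most one vote.  In that case
candidate 1 wins iff the arcs of seeds (n-l, n] and (1, l+1] both contain at
least two seeds and the second contains fewer than m/2 of them.  The exceptional
seed vectors have probability O(1/n) uniformly in l, and the arc event has
probability exactly pinf m (l/n), by a multinomial count.  Hence l_opt/n is an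
asymptotic maximizer of the continuous function pinf m on the compact interval
[0, 1/2], and therefore approaches the set of maximizers. *)

(** * Ranks and single votes on the oriented cycle *)

Lemma rankE (n s c : nat) : (1 <= s <= n)%N -> (1 <= c <= n)%N ->
  rank n s c = (if s <= c then c - s else n + c - s)%N.
Proof.
move=> hs hc; rewrite /rank; case: leqP => h.
  have -> : (c + n - s = c - s + n)%N by lia.
  by rewrite modnDr modn_small //; lia.
by rewrite modn_small; lia.
Qed.

Ltac rank_lia := rewrite !rankE; [repeat case: ifP => ?; lia | lia ..].

Lemma votes_forP (n : nat) (S : pred nat) (s i : nat) :
  reflect [/\ (1 <= i <= n)%N, S i &
    forall c, (1 <= c <= n)%N -> S c -> (rank n s i <= rank n s c)%N]
    (votes_for n S s i).
Proof.
apply: (iffP andP) => [[/andP[hi Si] /allP h]|[hi Si h]]; split => //.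
- move=> c hc Sc; have := h c; rewrite mem_iota -[c \in S]/(S c) Sc /=; apply; lia.
- by apply/andP.
- apply/allP => c; rewrite mem_iota => hc; apply/implyP => Sc; apply: h => //; lia.
Qed.

(** For even n the numbers 2i run through the even offsets up to n - 2l, which turns membership in A
    into arithmetic that [lia] decides. *)
Lemma ApartE (n l c : nat) : ~~ odd n -> (2 * l <= n)%N ->
  Apart n l c = ((1 <= c <= l) || (l < c <= n - l) && ~~ odd (c - l))%N.
Proof.
move=> on ln; rewrite /Apart; congr (_ || _); apply/hasP/andP.
  by move=> [i]; rewrite mem_iota => hi /eqP ->; lia.
move=> [hc oc]; exists (c - l)./2; first by rewrite mem_iota; lia.
by apply/eqP; lia.
Qed.

Lemma votes_exists (n : nat) (S : pred nat) (s c0 : nat) :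
  (1 <= c0 <= n)%N -> S c0 -> exists c, votes_for n S s c.
Proof.
move=> h0 S0.
have ex : exists r, has (fun c => S c && (rank n s c == r)) (iota 1 n).
  by exists (rank n s c0); apply/hasP; exists c0; rewrite ?mem_iota ?S0 ?eqxx //; lia.
case: (ex_minnP ex) => r /hasP [c]; rewrite mem_iota => hc /andP[Sc /eqP <-] hmin.
exists c; apply/votes_forP; split => //.
move=> d hd Sd; apply: hmin; apply/hasP; exists d; rewrite ?Sd ?eqxx // mem_iota; lia.
Qed.

(** Started anywhere but at c-1 or c, a list meets c-1 and, when c > 2, also c-2 before it reaches
    c. *)
Lemma votes_for_prev (n : nat) (S : pred nat) (s c : nat) :
  (1 <= s <= n)%N -> (1 < c)%N -> S c.-1 || (2 < c)%N && S c.-2 ->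
  votes_for n S s c -> (s == c) || (s == c.-1).
Proof.
move=> hs c1 hS /votes_forP [hc Sc hmin]; apply/negPn/negP => ne.
case/orP: hS => [S1|/andP[c2 S2]].
- by have := hmin c.-1 ltac:(lia) S1; rank_lia.
- by have := hmin c.-2 ltac:(lia) S2; rank_lia.
Qed.

(** * Votes inside A, inside B and in the duel between 1 and l+1 *)

Section partition.
Context (n l : nat).
Hypotheses (even_n : ~~ odd n) (l_range : (2 <= l <= n./2 - 1)%N).

Let AE c : Apart n l c = ((1 <= c <= l) || (l < c <= n - l) && ~~ odd (c - l))%N.
Proof. by apply: ApartE => //; lia. Qed.

(** Candidate n-l closes the alternating block of A, and those after it up to n lie in B, so exactly
    the seeds past n-l and the seed 1 reach 1 first. *)
Lemma Apart_votes_1 (s : nat) : (1 <= s <= n)%N ->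
  votes_for n (Apart n l) s 1 = (s == 1)%N || (n - l < s)%N.
Proof.
move=> hs; apply/votes_forP/idP => [[_ _ h]|h].
- have := h (n - l)%N ltac:(lia); rewrite AE => /(_ ltac:(lia)).
  by rank_lia.
- split; [lia|by rewrite AE; lia|] => c hc; rewrite AE => Sc.
  by rank_lia.
Qed.

(** The least member of B is l+1 and the greatest is n, so no seed past l+1 wraps around without
    meeting B. *)
Lemma Bpart_votes_l1 (s : nat) : (1 <= s <= n)%N ->
  votes_for n (Bpart n l) s l.+1 = (s <= l.+1)%N.
Proof.
move=> hs; apply/votes_forP/idP => [[_ _ h]|h].
- have := h n ltac:(lia); rewrite /Bpart AE => /(_ ltac:(lia)).
  by rank_lia.
- split; [lia|by rewrite /Bpart AE; lia|] => c hc; rewrite /Bpart AE => Sc.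
  by rank_lia.
Qed.

Lemma pair_votes_1 (s : nat) : (1 <= s <= n)%N ->
  votes_for n (pair_set 1 l.+1) s 1 = ~~ (1 < s <= l.+1)%N.
Proof.
move=> hs; apply/votes_forP/idP => [[_ _ h]|h].
- have := h l.+1 ltac:(lia); rewrite /pair_set => /(_ ltac:(lia)).
  by rank_lia.
- split; [lia|by rewrite /pair_set; lia|] => c hc; rewrite /pair_set => Sc.
  by rank_lia.
Qed.

Lemma pair_votes_l1 (s : nat) : (1 <= s <= n)%N ->
  votes_for n (pair_set 1 l.+1) s l.+1 = (1 < s <= l.+1)%N.
Proof.
move=> hs; apply/votes_forP/idP => [[_ _ h]|h].
- have := h 1%N ltac:(lia); rewrite /pair_set => /(_ ltac:(lia)).
  by rank_lia.
- split; [lia|by rewrite /pair_set; lia|] => c hc; rewrite /pair_set => Sc.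
  by rank_lia.
Qed.

(** The preceding member of A is one step back inside 1..l and two steps back in the alternating
    block, where l precedes l+2. *)
Lemma Apart_votes_other (s c : nat) : (1 <= s <= n)%N -> c != 1%N ->
  votes_for n (Apart n l) s c -> (s == c) || (s == c.-1).
Proof.
move=> hs c1 hv; have := hv => /votes_forP [hc].
rewrite AE => Sc _; apply: votes_for_prev hv => //; first lia.
by rewrite !AE; lia.
Qed.

(** In B the steps of length two extend up to n-l+1; from there on the candidates are
    consecutive. *)
Lemma Bpart_votes_other (s c : nat) : (1 <= s <= n)%N -> c != l.+1 ->
  votes_for n (Bpart n l) s c -> (s == c) || (s == c.-1).
Proof.
move=> hs c1 hv; have := hv => /votes_forP [hc].
rewrite /Bpart AE => Sc _; apply: votes_for_prev hv => //; first lia.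
by rewrite /Bpart !AE; lia.
Qed.

End partition.

(** * Reduction of the victory of candidate 1 to an event on two arcs *)

(* The set comprehensions in the definitions of [Xi] and [p1] are classical sets. *)
Lemma card_mkset (T : finType) (P : pred T) :
  #|[set x | P x]%classic| = #|[set x | P x]|.
Proof. by apply: eq_card => x; rewrite [RHS]finset.in_set; apply: asboolb. Qed.

Lemma XiE (n m : nat) (S : pred nat) (s : {ffun 'I_m -> 'I_n}) (i : nat) :
  Xi S s i = #|[set j | votes_for n S (s j).+1 i]|.
Proof. exact: card_mkset. Qed.

(* [s j] is the seed of voter j minus 1, so these count the seeds in (1, l+1] and in
   (n-l, n]. *)
Definition left_count {n m : nat} (l : nat) (s : {ffun 'I_m -> 'I_n}) : nat :=
  #|[set j | (0 < s j <= l)%N]|.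

Definition right_count {n m : nat} (l : nat) (s : {ffun 'I_m -> 'I_n}) : nat :=
  #|[set j | (n - l <= s j)%N]|.

Definition arc_event {n m : nat} (l : nat) (s : {ffun 'I_m -> 'I_n}) : bool :=
  [&& 2 <= right_count l s, 2 <= left_count l s & (left_count l s).*2 < m]%N.

(** Quantifying over ordered pairs covers both neighbours of a seed. The cyclic adjacency of n and 1
    is excluded by the first clause. *)
Definition well_spaced {n m : nat} (s : {ffun 'I_m -> 'I_n}) : Prop :=
  (forall j, (0 < s j)%N) /\
  (forall i j, i != j -> (s j != s i :> nat) /\ (s j != (s i).+1 :> nat)).

(** Two voters for c would both have seeds in {c-1, c}, hence equal or adjacent ones. *)
Lemma Xi_le1 (n m : nat) (S : pred nat) (s : {ffun 'I_m -> 'I_n}) (c : nat) :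
  well_spaced s ->
  (forall t, (1 <= t <= n)%N -> votes_for n S t c -> (t == c) || (t == c.-1)) ->
  (Xi S s c <= 1)%N.
Proof.
move=> [_ sep] hc; rewrite XiE; apply/card_le1_eqP => i j; rewrite !inE => vi vj.
apply/eqP/negPn/negP => nij.
have := sep _ _ nij; have := sep i j; rewrite eq_sym => /(_ nij).
have := hc _ _ vi; have := hc _ _ vj; have := ltn_ord (s i); have := ltn_ord (s j).
by lia.
Qed.

(** If a had at most one vote, one of the m > 1 voters would choose some other c, and a would have
    to beat that vote strictly. *)
Lemma winner_Xi_ge2 (n m : nat) (S : pred nat) (s : {ffun 'I_m -> 'I_n}) (a : nat) :
  (1 < m)%N -> winner S s a -> (2 <= Xi S s a)%N.
Proof.
move=> m1 /andP[/andP[ha Sa] /allP h].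
rewrite leqNgt; apply/negP => Xa.
have [j hj] : exists j, ~~ votes_for n S (s j).+1 a.
  apply/existsP; rewrite -negb_forall; apply/negP => /forallP hall.
  suff : Xi S s a = m by lia.
  by rewrite XiE -[RHS]card_ord; apply: eq_card => j; rewrite inE hall.
have [c hc] := @votes_exists n S (s j).+1 a ha Sa.
have := hc => /votes_forP [rc Sc _].
have cj : c != a by apply: contraNneq hj => <-.
have := h c; rewrite mem_iota -[c \in S]/(S c) Sc cj /= => /(_ ltac:(lia)).
have : (0 < Xi S s c)%N by rewrite XiE; apply/card_gt0P; exists j; rewrite inE.
by lia.
Qed.

Lemma wins2_arc_event (n m l : nat) (s : {ffun 'I_m -> 'I_n}) :
  ~~ odd n -> (2 <= l <= n./2 - 1)%N -> (1 < m)%N -> well_spaced s ->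
  wins2 (Apart n l) (Bpart n l) s 1 = arc_event l s.
Proof.
move=> on hl m1 sep; have [s0 _] := sep.
have rs j : (1 <= (s j).+1 <= n)%N by have := ltn_ord (s j); lia.
have A1 : Apart n l 1 by rewrite ApartE //; lia.
have B1 : Bpart n l l.+1 by rewrite /Bpart ApartE //; lia.
(* Here and in [XB1], [s0] excludes the seed 1, which votes for 1 in A and for l+1 in B but lies in
   neither arc. *)
have XA1 : Xi (Apart n l) s 1 = right_count l s.
  rewrite XiE; apply: eq_card => j; rewrite !inE Apart_votes_1 //.
  by have := s0 j; lia.
have XB1 : Xi (Bpart n l) s l.+1 = left_count l s.
  rewrite XiE; apply: eq_card => j; rewrite !inE Bpart_votes_l1 //.
  by have := s0 j; lia.
have XP : Xi (pair_set 1 l.+1) s l.+1 = left_count l s.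
  by rewrite XiE; apply: eq_card => j; rewrite !inE pair_votes_l1.
(* Every voter of the duel chooses 1 or l+1, so 1 wins it exactly when [left_count] is less than
   m/2. *)
have XP1 : (Xi (pair_set 1 l.+1) s 1 + left_count l s = m)%N.
  rewrite addnC XiE /left_count -[RHS]card_ord -(cardsC [set j | (0 < s j <= l)%N]).
  by congr (_ + _)%N; apply: eq_card => j; rewrite !inE pair_votes_1.
have XA c : c != 1%N -> (Xi (Apart n l) s c <= 1)%N.
  by move=> c1; apply: Xi_le1 => // t ht; apply: Apart_votes_other.
have XB c : c != l.+1 -> (Xi (Bpart n l) s c <= 1)%N.
  by move=> c1; apply: Xi_le1 => // t ht; apply: Bpart_votes_other.
(* First-round winners have at least two votes, which leaves only a = 1 and b = l+1. *)
apply/idP/idP => [/hasP [a ha /hasP [b hb /and3P[wa wb]]]|].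
- have := winner_Xi_ge2 _ _ _ _ _ m1 wa; have := winner_Xi_ge2 _ _ _ _ _ m1 wb.
  have [->|/XA] := eqVneq a 1%N; last by lia.
  have [->|/XB] := eqVneq b l.+1; last by lia.
  by rewrite /arc_event XA1 XB1 XP; lia.
- move=> /and3P [r2 l2 lm].
  apply/hasP; exists 1%N; first by rewrite mem_iota; lia.
  apply/hasP; exists l.+1; first by rewrite mem_iota; lia.
  have -> : winner (Apart n l) s 1.
    apply/andP; split; first by apply/andP; split; [lia|].
    apply/allP => c _; apply/implyP => /andP[_ /XA]; by rewrite XA1; lia.
  have -> : winner (Bpart n l) s l.+1.
    apply/andP; split; first by apply/andP; split; [lia|].
    apply/allP => c _; apply/implyP => /andP[_ /XB]; by rewrite XB1; lia.
  by rewrite XP /=; lia.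
Qed.

(** * Probability of the exceptional seed vectors *)

(** Each exceptional condition (a seed equal to 1, to another seed or to its successor) fixes one
    coordinate in terms of the rest and so costs a factor n. *)
Lemma card_coordinate_event (n m : nat) (E : {set {ffun 'I_m -> 'I_n}}) (j : 'I_m) :
  {in E &, forall s t : {ffun 'I_m -> 'I_n}, (forall i, i != j -> s i = t i) -> s j = t j} ->
  (#|E| * n <= n ^ m)%N.
Proof.
move=> hE.
(* Overwriting coordinate j is injective on E x 'I_n: an element of E is
   determined by its other coordinates. *)
pose upd (p : {ffun 'I_m -> 'I_n} * 'I_n) : {ffun 'I_m -> 'I_n} :=
  [ffun i => if i == j then p.2 else p.1 i].
have inj : {in finset.setX E [set: 'I_n] &, injective upd}.
  move=> [s v] [t w]; rewrite !inE /= !andbT => sE tE /ffunP e.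
  have off i : i != j -> s i = t i.
    by move=> ij; have := e i; rewrite !ffunE /= (negPf ij).
  have -> : v = w by have := e j; rewrite !ffunE /= eqxx.
  congr (_, _); apply/ffunP => i; have [->|/off//] := eqVneq i j.
  exact: hE.
have := max_card (mem (upd @: finset.setX E [set: 'I_n])).
by rewrite card_in_imset // cardsX cardsT card_ffun !card_ord.
Qed.

Lemma card_bigcup_le (I T : finType) (P : pred I) (F : I -> {set T}) :
  (#|\bigcup_(i | P i) F i| <= \sum_(i | P i) #|F i|)%N.
Proof.
elim/big_rec2: _ => [|i x A _ h]; first by rewrite cards0.
by rewrite (leq_trans (leq_card_setU _ _)) // leq_add2l.
Qed.

(** Outside [bad] the two events agree, so their cardinalities differ by at most [#|bad|]. The
    constant is a union bound: m events for the seed 1, and two, equality and succession, for each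
    of at most m^2 ordered pairs. *)
Lemma p1_arc_event {R : realType} (n m l : nat) :
  ~~ odd n -> (2 <= l <= n./2 - 1)%N -> (1 < m)%N ->
  `|p1 n m l - #|[set s : {ffun 'I_m -> 'I_n} | arc_event l s]|%:R / (n ^ m)%:R|
    <= (m + 2 * m ^ 2)%:R / n%:R :> R.
Proof.
move=> on hl m1; have n0 : (0 < n)%N by lia.
pose E (j : 'I_m) := [set s : {ffun 'I_m -> 'I_n} | s j == 0 :> nat].
pose F (p : 'I_m * 'I_m) :=
  [set s : {ffun 'I_m -> 'I_n} | s p.2 == s p.1 :> nat].
pose G (p : 'I_m * 'I_m) :=
  [set s : {ffun 'I_m -> 'I_n} | s p.2 == (s p.1).+1 :> nat].
pose bad := \bigcup_j E j :|: \bigcup_(p | p.1 != p.2) (F p :|: G p).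
have badE s : s \notin bad -> well_spaced s.
  rewrite !inE negb_or => /andP[/bigcupP b1 /bigcupP b2]; split => [j|i j ij].
    rewrite lt0n; apply/negP => sj; apply: b1; exists j => //; by rewrite inE.
  split; apply/negP => sj; apply: b2; exists (i, j) => //; rewrite !inE /= sj //.
  exact: orbT.
have cardE j : (#|E j| * n <= n ^ m)%N.
  apply: (@card_coordinate_event _ _ _ j) => s t; rewrite !inE => /eqP a /eqP b _.
  by apply: val_inj => /=; rewrite a b.
have cardF p : p.1 != p.2 -> (#|F p| * n <= n ^ m)%N.
  move=> hp; apply: (@card_coordinate_event _ _ _ p.2) => s t.
  rewrite !inE => /eqP a /eqP b /(_ _ hp) e.
  by apply: val_inj => /=; rewrite a b e.
have cardG p : p.1 != p.2 -> (#|G p| * n <= n ^ m)%N.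
  move=> hp; apply: (@card_coordinate_event _ _ _ p.2) => s t.
  rewrite !inE => /eqP a /eqP b /(_ _ hp) e.
  by apply: val_inj => /=; rewrite a b e.
have card_bad : (#|bad| * n <= (m + 2 * m ^ 2) * n ^ m)%N.
  rewrite (leq_trans (leq_mul (leq_card_setU _ _) (leqnn n))) // mulnDl [X in (_ <= X)%N]mulnDl leq_add //.
    rewrite (leq_trans (leq_mul (card_bigcup_le _ _ _ _) (leqnn n))) // big_distrl /=.
    by rewrite -[X in (_ <= X * _)%N]card_ord -sum_nat_const leq_sum.
  rewrite (leq_trans (leq_mul (card_bigcup_le _ _ _ _) (leqnn n))) // big_distrl /=.
  have -> : (2 * m ^ 2 * n ^ m = \sum_(p : 'I_m * 'I_m) 2 * n ^ m)%N.
    by rewrite sum_nat_const card_prod !card_ord; lia.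
  (* Diagonal pairs are absent from the union; their zero terms are bounded by the full summand. *)
  rewrite big_mkcond leq_sum // => p _; case: ifP => // /[dup] /cardF Fp /cardG Gp.
  by rewrite (leq_trans (leq_mul (leq_card_setU _ _) (leqnn n))) // mulnDl; lia.
pose A := [set s : {ffun 'I_m -> 'I_n} | wins2 (Apart n l) (Bpart n l) s 1].
set B := [set s | arc_event l s].
have AB s : s \notin bad -> (s \in A) = (s \in B).
  by move=> /badE sep; rewrite !inE wins2_arc_event.
have cle (X Y : {set {ffun 'I_m -> 'I_n}}) :
    (forall s, s \notin bad -> (s \in X) = (s \in Y)) -> (#|X| <= #|Y| + #|bad|)%N.
  move=> XY; rewrite (leq_trans _ (leq_card_setU _ _)) // subset_leq_card //.
  apply/fintype.subsetP => s sX; rewrite inE; case: (boolP (s \in bad)) => [|/XY <-].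
    by rewrite orbT.
  by rewrite sX.
have c1 := cle _ _ AB; have c2 := cle B A (fun s h => esym (AB s h)).
have nm0 : 0 < (n ^ m)%:R :> R by rewrite ltr0n expn_gt0 n0.
rewrite /p1 card_mkset -/A -mulrBl normrM [X in _ * X]gtr0_norm ?invr_gt0 //.
rewrite ler_pdivrMr // mulrAC ler_pdivlMr ?ltr0n //.
apply: (@le_trans _ _ (#|bad|%:R * n%:R)); last by rewrite -!natrM ler_nat.
rewrite ler_wpM2r // ler_norml.
by move: c1 c2; rewrite -!(ler_nat R) !natrD => c1 c2; lra.
Qed.

(** * Exact probability of the arc event *)

(** Once it is prescribed which voters have seeds in I and which in J, the coordinates vary
    independently: the vectors form the product family [F]. *)
Lemma card_preim_pair (n m : nat) (I J : {set 'I_n}) (A B : {set 'I_m}) :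
  [disjoint I & J] -> [disjoint A & B] ->
  #|[set s : {ffun 'I_m -> 'I_n} | (s @^-1: I == A) && (s @^-1: J == B)]| =
  (#|I| ^ #|A| * #|J| ^ #|B| * (n - #|I| - #|J|) ^ (m - #|A| - #|B|))%N.
Proof.
move=> dIJ dAB.
pose F (j : 'I_m) := if j \in A then I else if j \in B then J else ~: (I :|: J).
have cC T (X Y : {set T}) : [disjoint X & Y] -> #|~: (X :|: Y)| = (#|T| - #|X| - #|Y|)%N.
  by move=> d; rewrite cardsCs finset.setCK cardsU disjoint_setI0 // cards0; lia.
have e : [set s : {ffun 'I_m -> 'I_n} | (s @^-1: I == A) && (s @^-1: J == B)] =i
    family F.
  move=> s; rewrite inE; apply/andP/familyP => [[/eqP eA /eqP eB] j|h].
    by rewrite /F -eA -eB !inE; do 2 case: ifP => //; rewrite !inE => -> ->.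
  split; apply/eqP/finset.setP => j; have := h j; rewrite /F !inE.
    case: ifP => // jA; case: ifP => jB; rewrite ?inE.
      by move=> sJ; apply: contraTF sJ => /(disjointFr dIJ) ->.
    by rewrite negb_or => /andP[/negPf].
  case: ifP => jA; rewrite ?inE.
    by move=> /(disjointFr dIJ) ->; rewrite (disjointFr dAB).
  by case: ifP => // jB; rewrite ?inE negb_or => /andP[_ /negPf].
rewrite (eq_card e) card_family foldrE big_map big_enum /=.
(* The product of the [#|F j|] splits over A, B and the remaining coordinates. *)
rewrite (bigID (mem A)) /= (bigID (mem B) (fun j => j \notin A)) /= mulnA.
congr (_ * _ * _)%N.
- by rewrite -prod_nat_const; apply: eq_bigr => j; rewrite /F => ->.
- rewrite -prod_nat_const; apply: eq_big => j.
    by case: (boolP (j \in B)) => jB; rewrite ?andbF // (disjointFl dAB).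
  by rewrite /F => /andP[/negPf -> ->].
- have := cC _ _ _ dAB; rewrite card_ord => <-.
  have := cC _ _ _ dIJ; rewrite card_ord => <-; rewrite -prod_nat_const.
  apply: eq_big => j; first by rewrite !inE negb_or.
  by rewrite /F => /andP[/negPf -> /negPf ->].
Qed.

(** Group the vectors by their two preimages. All fibres have the same size [c], and the binomials
    count the choices of A and then of B in its complement. *)
Lemma card_preim_sizes (n m : nat) (I J : {set 'I_n}) (a b : nat) :
  [disjoint I & J] ->
  #|[set s : {ffun 'I_m -> 'I_n} | (#|s @^-1: I| == a) && (#|s @^-1: J| == b)]| =
  ('C(m, a) * 'C(m - a, b)
    * (#|I| ^ a * #|J| ^ b * (n - #|I| - #|J|) ^ (m - a - b)))%N.
Proof.
move=> dIJ.
pose Q (p : {set 'I_m} * {set 'I_m}) :=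
  (#|p.1| == a) && ((p.2 \subset ~: p.1) && (#|p.2| == b)).
rewrite -sum1dep_card.
rewrite (partition_big (fun s : {ffun 'I_m -> 'I_n} => (s @^-1: I, s @^-1: J)) Q) /=;
  last first.
  move=> s /andP[sa sb]; rewrite /Q /= sa sb /= andbT; apply/fintype.subsetP => j.
  by rewrite !inE => /(disjointFl dIJ) ->.
set c := (#|I| ^ a * _ * _)%N.
transitivity (\sum_(p | Q p) c)%N.
  apply: eq_bigr => -[A B] /and3P [/= /eqP hA sBA /eqP hB].
  rewrite sum1dep_card /c -hA -hB -card_preim_pair //; last first.
    by rewrite disjoint_sym finset.disjoints_subset.
  apply: eq_card => s; rewrite !inE xpair_eqE.
  by apply: andb_idl => /andP[/eqP -> /eqP ->]; rewrite ?hA ?hB !eqxx.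
rewrite -(pair_big_dep (fun A : {set 'I_m} => #|A| == a)
  (fun A B : {set 'I_m} => (B \subset ~: A) && (#|B| == b)) (fun _ _ => c)) /=.
transitivity (\sum_(A : {set 'I_m} | #|A| == a) 'C(m - a, b) * c)%N.
  apply: eq_bigr => A /eqP hA; rewrite sum_nat_const; congr (_ * _)%N.
  have -> : (m - a = #|~: A|)%N by rewrite cardsCs finset.setCK card_ord hA.
  by rewrite -cards_draws; apply: eq_card => B; rewrite inE.
rewrite sum_nat_const -mulnA; congr (_ * _)%N.
have := card_draws 'I_m a; rewrite card_ord => <-.
by apply: eq_card => B; rewrite inE.
Qed.

Lemma card_ord_itv (n a b : nat) : (b <= n)%N ->
  #|[set i : 'I_n | (a <= i < b)%N]| = (b - a)%N.
Proof.
move=> bn; rewrite -sum1dep_card -(big_mkord (fun i => a <= i < b)%N (fun=> 1%N)).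
rewrite -big_nat_widen //= -(@big_nat_widenl _ _ _ a 0 b predT (fun=> 1%N)) //.
by rewrite sum_nat_const_nat muln1.
Qed.

Lemma card_arc_event (n m l : nat) : (2 * l < n)%N -> (0 < m)%N ->
  #|[set s : {ffun 'I_m -> 'I_n} | arc_event l s]| =
  (\sum_(2 <= a < ((m - 1) %/ 2).+1) \sum_(2 <= b < (m - a).+1)
    'C(m, a) * 'C(m - a, b) * (l ^ (a + b) * (n - 2 * l) ^ (m - a - b)))%N.
Proof.
move=> ln m0.
(* Values are seeds minus 1: I stands for the seeds 2..l+1 and J for n-l+1..n. *)
pose I := [set i : 'I_n | (1 <= i < l.+1)%N]; pose J := [set i : 'I_n | (n - l <= i < n)%N].
have cI : #|I| = l by rewrite card_ord_itv; lia.
have cJ : #|J| = l by rewrite card_ord_itv; lia.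
have dIJ : [disjoint I & J].
  by rewrite finset.disjoints_subset; apply/fintype.subsetP => i; rewrite !inE; lia.
have lE (s : {ffun 'I_m -> 'I_n}) : left_count l s = #|s @^-1: I|.
  by apply: eq_card => j; rewrite !inE.
have rE (s : {ffun 'I_m -> 'I_n}) : right_count l s = #|s @^-1: J|.
  by apply: eq_card => j; rewrite !inE ltn_ord andbT.
have lr (s : {ffun 'I_m -> 'I_n}) : (left_count l s + right_count l s <= m)%N.
  rewrite lE rE -[leqRHS]card_ord -cardsUI disjoint_setI0 ?cards0 ?addn0 ?max_card //.
  rewrite finset.disjoints_subset; apply/fintype.subsetP => j; rewrite !inE; lia.
(* A vector is counted by the only index pair that equals its two counts, if that pair is in range;
   the indicator form lets the sums be exchanged. *)
transitivity (\sum_(2 <= a < ((m - 1) %/ 2).+1) \sum_(2 <= b < (m - a).+1)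
    \sum_(s : {ffun 'I_m -> 'I_n})
      if (b == right_count l s) && (a == left_count l s) then 1 else 0)%N; last first.
  apply: eq_bigr => a _; apply: eq_bigr => b _.
  rewrite -big_mkcond sum1dep_card.
  have := card_preim_sizes _ m _ _ a b dIJ.
  rewrite cI cJ expnD -subnDA addnn -mul2n => <-.
  apply: eq_card => s; rewrite !inE -lE -rE andbC.
  by rewrite (eq_sym a) (eq_sym b).
under eq_bigr do rewrite exchange_big.
rewrite exchange_big -sum1dep_card big_mkcond; apply: eq_bigr => s _ /=.
transitivity (\sum_(2 <= a < ((m - 1) %/ 2).+1 | a == left_count l s)
   (if (2 <= right_count l s < (m - a).+1) then 1 else 0))%N; last first.
  rewrite big_mkcond; apply: eq_bigr => a _; case: eqP => [->|_].
    by under eq_bigr do rewrite andbT; rewrite -big_mkcond big_nat1_eq.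
  by rewrite big1 // => b _; rewrite andbF.
rewrite big_nat1_eq /arc_event -if_and; congr (if _ then _ else _).
(* By [lr] the bound b <= m - a holds automatically, and as m > 0 the bound on a says 2a < m. *)
by have := lr s; lia.
Qed.

(** At eta = l/n the base 1 - 2 eta is (n - 2l)/n, and the exponents of each term add up to m, which
    gives the common denominator n^m. *)
Lemma pinf_arc_event {R : realType} (n m l : nat) :
  (2 * l < n)%N -> (0 < m)%N ->
  pinf m (l%:R / n%:R) =
    #|[set s : {ffun 'I_m -> 'I_n} | arc_event l s]|%:R / (n ^ m)%:R :> R.
Proof.
move=> ln m0; rewrite card_arc_event // natr_sum mulr_suml /pinf big_nat [RHS]big_nat.
apply: eq_bigr => a ha; rewrite natr_sum mulr_suml big_nat [RHS]big_nat.
apply: eq_bigr => b hb.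
have [c mE] : exists c, m = (a + (b + c))%N by exists (m - a - b)%N; lia.
have -> : (m - a - b = c)%N by lia.
have n0 : n%:R != 0 :> R by rewrite pnatr_eq0; lia.
have -> : 1 - 2 * (l%:R / n%:R) = (n - 2 * l)%:R / n%:R :> R.
  by rewrite natrB; [rewrite natrM mulrBl divff // mulrA|lia].
(* The multinomial coefficient is a product of two binomials. *)
have fE : (m`! = 'C(m, a) * 'C(m - a, b) * (a`! * b`! * c`!))%N.
  have := bin_fact (leq_addr (b + c) a); rewrite -mE => <-.
  have -> : (m - a = b + c)%N by lia.
  have := bin_fact (leq_addr c b); rewrite addKn => <-; lia.
rewrite fE; set d := ('C(m, a) * _)%N.
rewrite natrM mulfK ?pnatr_eq0 -?lt0n ?muln_gt0 ?fact_gt0 //.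
rewrite natrM -!mulrA; congr (_ * _).
rewrite !expr_div_n natrM !natrX mulf_div; congr (_ / _).
by rewrite -exprD -addnA -mE.
Qed.

(** * Continuity, compactness and asymptotic maximizers *)

Local Open Scope classical_set_scope.

Lemma continuous_pinf {R : realType} (m : nat) : continuous (@pinf R m).
Proof.
pose p : {poly R} := \sum_(2 <= s < ((m - 1) %/ 2).+1) \sum_(2 <= t < (m - s).+1)
  ((m`!)%:R / ((s`! * t`! * (m - s - t)`!)%N)%:R)%:P
    * 'X ^+ (s + t) * (1 - 2%:P * 'X) ^+ (m - s - t).
suff -> : @pinf R m = horner p by exact: continuous_horner.
apply/funext => x; rewrite /pinf /p horner_sum; apply: eq_bigr => s _.
by rewrite horner_sum; apply: eq_bigr => t _; rewrite !(hornerE, horner_exp).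
Qed.

(** [Estar m] is convertible to [argmax (pinf m) 0 2^-1]. *)
Definition argmax {R : realType} (f : R -> R) (a b : R) : set R :=
  [set e | a <= e <= b /\ forall x, a <= x <= b -> f x <= f e].

(** The points of [a, b] at distance at least eps from every maximizer form a compact set K. On K
    the maximum of f stays below f e, since a maximizer in K would be at distance 0 from itself; the
    gap serves as delta. *)
Lemma near_argmax (R : realType) (f : R -> R) (a b e eps : R) :
  continuous f -> 0 < eps -> argmax f a b e ->
  exists2 delta, 0 < delta & forall x, a <= x <= b -> f e - delta < f x ->
    exists2 e', argmax f a b e' & `|x - e'| < eps.
Proof.
move=> cf eps0 [abe maxe].
pose K := `[a, b] `&` \bigcap_(y in argmax f a b) [set x | eps <= `|x - y|].
have far x : a <= x <= b -> ~ K x -> exists2 e', argmax f a b e' & `|x - e'| < eps.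
  move=> abx nK; apply: contrapT => nex; apply: nK; split; first by rewrite /= in_itv.
  by move=> y hy /=; rewrite leNgt; apply/negP => lt; apply: nex; exists y.
have [K0|/set0P/negP/negPn/eqP K0] := pselect (K !=set0); last first.
  (* With K empty every point is near a maximizer, and any delta will do. *)
  by exists 1 => // x abx _; apply: far; rewrite // K0.
have cK : compact K.
  apply: compact_closedI; first exact: segment_compact.
  apply: closed_bigI => y _.
  apply: (@preimage_closed _ _ (fun x => `|x - y|) [set z | eps <= z]); last exact: closed_ge.
  move=> x _; apply: (@continuous_comp _ _ _ (fun x => x - y) Num.norm); last exact: norm_continuous.
  by apply: cvgB; [exact: cvg_id|exact: cvg_cst].
have [c] := compact_EVT_max K0 cK (continuous_subspaceT cf).
rewrite in_setE => -[/=]; rewrite in_itv /= => abc farc maxc.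
have fce : f c < f e.
  rewrite lt_neqAle maxe // andbT; apply/eqP => fE.
  have /farc /= : argmax f a b c by split => // x abx; rewrite fE maxe.
  by rewrite subrr normr0 leNgt eps0.
exists (f e - f c); first by rewrite subr_gt0.
move=> x abx; rewrite subKr => fx; apply: far => // Kx.
by move: fx; rewrite ltNge maxc // in_setE.
Qed.

Lemma p1_pinf {R : realType} (n m l : nat) :
  ~~ odd n -> (2 <= l <= n./2 - 1)%N -> (1 < m)%N ->
  `|p1 n m l - pinf m (l%:R / n%:R)| <= (m + 2 * m ^ 2)%:R / n%:R :> R.
Proof.
by move=> on hl m1; rewrite pinf_arc_event; [exact: p1_arc_event|lia|lia].
Qed.

(** With n = 2k, take l as the integer part of e n: e k > 1 gives l >= 2, e < 1/2 gives l < k, and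
    truncation costs less than 1/n. *)
Lemma grid_point {R : realType} (e : R) (k : nat) :
  0 < e < 2^-1 -> e^-1 < k%:R ->
  exists2 l : nat, (2 <= l <= k - 1)%N & `|e - l%:R / (k.*2)%:R| < k%:R^-1.
Proof.
move=> /andP[e0 e1] ek.
have k0 : 0 < k%:R :> R by apply: lt_trans ek; rewrite invr_gt0.
have ek1 : 1 < e * k%:R by rewrite -(ltr_pM2l e0) divff ?gt_eqF // in ek.
have nE : (k.*2)%:R = 2 * k%:R :> R by rewrite -mul2n natrM.
have /truncn_itv : 0 <= e * (k.*2)%:R by rewrite nE; nra.
set l := Num.truncn _ => /andP[l1 l2]; rewrite nE in l1 l2; exists l.
  have : (2 < l.+1)%N by rewrite -(ltr_nat R); nra.
  have : (l < k)%N by rewrite -(ltr_nat R); nra.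
  by clear; lia.
have -> : e - l%:R / (k.*2)%:R = (e * (2 * k%:R) - l%:R) / (2 * k%:R).
  by rewrite nE; field; rewrite gt_eqF.
rewrite ger0_norm ?divr_ge0 ?subr_ge0 ?mulr_ge0 //.
rewrite ltr_pdivrMr ?mulr_gt0 // [X in _ < X]mulrCA mulVf ?gt_eqF // mulr1.
by move: l2; move: (e * _) => x; clear; lra.
Qed.

(** Even n is written 2k. For a grid point l/n close to a maximizer e, pinf(l_opt/n) > p1(l_opt) -
    delta/3 >= p1(l) - delta/3 > pinf(l/n) - 2 delta/3 > pinf(e) - delta, so [near_argmax] applies
    to l_opt/n. *)
Lemma lopt_near_argmax (R : realType) (m : nat) (lopt : nat -> nat) :
  (@Estar R m `<=` [set x | 0 < x < 2^-1]) ->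
  (forall n : nat, (6 <= n)%N -> ~~ odd n ->
     (2 <= lopt n <= n./2 - 1)%N /\
     (forall l : nat, (2 <= l <= n./2 - 1)%N ->
        @p1 R n m l <= @p1 R n m (lopt n))) ->
  forall eps : R, 0 < eps -> \forall k \near \oo,
    exists2 e, @Estar R m e & `|(lopt k.*2)%:R / (k.*2)%:R - e| < eps.
Proof.
move=> interior opt eps eps0.
(* For m <= 1 the function pinf m vanishes, so 0 is a maximizer. *)
have m1 : (1 < m)%N.
  rewrite ltnNge; apply/negP => m1.
  have p0 x : @pinf R m x = 0 by rewrite /pinf big_geq //; lia.
  have /interior /= : @Estar R m 0 by split => [|x _]; [lra|rewrite !p0].
  by rewrite ltxx.
have cf := @continuous_pinf R m.
have [e] := @EVT_max R (pinf m) 0 2^-1 ltac:(lra) (continuous_subspaceT cf).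
rewrite in_itv /= => e01 emax.
have Ee : Estar m e by split => // x hx; apply: emax; rewrite in_itv.
have /andP[e0 e1] := interior _ Ee.
have [delta delta0 close] := @near_argmax R (pinf m) 0 2^-1 e eps cf eps0 Ee.
have delta3 : 0 < delta / 3 by lra.
have /cvgrPdist_lt /(_ _ delta3) /nbhs_ballP [r /= r0 near_e] := cf e.
near=> k.
have k3 : (3 <= k)%N by near: k; exact: nbhs_infty_ge.
(* This threshold brings the error of [p1_pinf] below delta/3; the next two place the grid point
   within r of e and meet the hypothesis of [grid_point]. *)
have kC : 3 * (m + 2 * m ^ 2)%:R / delta < k%:R by near: k; exact: nbhs_infty_gtr.
have kr : r^-1 < k%:R by near: k; exact: nbhs_infty_gtr.
have ke : e^-1 < k%:R by near: k; exact: nbhs_infty_gtr.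
have k0 : 0 < k%:R :> R by rewrite ltr0n (leq_trans _ k3).
have [l hl le] := grid_point e k (interior _ Ee) ke.
have n6 : (6 <= k.*2)%N by rewrite (leq_double 3).
have on : ~~ odd k.*2 by rewrite odd_double.
have [hlopt optn] := opt _ n6 on.
rewrite doubleK in hlopt optn.
have a1 := @p1_pinf R k.*2 m l on; rewrite doubleK in a1; have {}a1 := a1 hl m1.
have a2 := @p1_pinf R k.*2 m (lopt k.*2) on; rewrite doubleK in a2.
have {}a2 := a2 hlopt m1.
have a3 := optn l hl.
have nE : (k.*2)%:R = 2 * k%:R :> R by rewrite -mul2n natrM.
have Cn : (m + 2 * m ^ 2)%:R / (k.*2)%:R < delta / 3.
  have dk : 0 < delta * k%:R by rewrite mulr_gt0.
  rewrite nE ltr_pdivrMr ?mulr_gt0 //; move: kC; rewrite ltr_pdivrMr //.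
  by move: (m + _)%:R => C; clear -dk; lra.
have fe : `|pinf m e - pinf m (l%:R / (k.*2)%:R)| < delta / 3.
  by apply: near_e; rewrite /ball /= (lt_trans le) // invf_plt ?posrE.
apply: close.
  rewrite divr_ge0 //= nE ler_pdivrMr ?mulr_gt0 // mulKf ?ler_nat //.
  by clear -hlopt; lia.
move: a1 a2 fe a3 Cn; rewrite ler_norml ler_norml ltr_norml.
move: (_ / _) (p1 _ _ _) (p1 _ _ _) (pinf _ _) (pinf _ _) (pinf _ _).
by move=> p q r1 r2 r3 r4; clear; move=> *; lra.
Unshelve. all: by end_near.
Qed.

Theorem mainTheorem12 (R : realType) (m : nat) (lopt : nat -> nat) :
  (@Estar R m `<=` [set x | 0 < x < 2^-1]) ->
  (forall n : nat, (6 <= n)%N -> ~~ odd n ->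
     (2 <= lopt n <= n./2 - 1)%N /\
     (forall l : nat, (2 <= l <= n./2 - 1)%N ->
        @p1 R n m l <= @p1 R n m (lopt n))) ->
  ((fun k : nat =>
      inf [set `|(lopt k.*2)%:R / (k.*2)%:R - e| | e in @Estar R m])
     @ \oo --> (0 : R))
  /\
  (forall eta_opt : R, @Estar R m = [set eta_opt] ->
     (fun k : nat => (lopt k.*2)%:R / (k.*2)%:R : R) @ \oo --> eta_opt).
Proof.
move=> interior opt; have H := lopt_near_argmax R m lopt interior opt.
split => [|eta etaE]; apply/cvgrPdist_lt => eps eps0.
  near=> k; have [e Ee he] : exists2 e, @Estar R m e &
      `|(lopt k.*2)%:R / (k.*2)%:R - e| < eps by near: k; exact: H.
  set S := image _ _.
  (* The lower bound 0 yields both the sign of the infimum and the boundedness that [ge_inf]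
     requires. *)
  have S0 : lbound S 0 by move=> _ [y _ <-].
  have Se : S `|(lopt k.*2)%:R / (k.*2)%:R - e| by exists e.
  rewrite sub0r normrN ger0_norm; last by apply: lb_le_inf => //; eexists; exact: Se.
  by apply: le_lt_trans he; apply: ge_inf => //; exists 0.
near=> k; have [e Ee he] : exists2 e, @Estar R m e &
    `|(lopt k.*2)%:R / (k.*2)%:R - e| < eps by near: k; exact: H.
by move: Ee; rewrite etaE => <-; rewrite distrC.
Unshelve. all: by end_near.
Qed.
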